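(* Let $X$ be a set with $|X|\ge 2$ and let $i\in\{\varnothing,ls,rs,s\}$. Then the $(X\cup\overline{X^+})$-generated birestriction monoid $\mathcal F_i=\mathrm{BRestr}\langle X\cup\overline{X^+}\mid N_i\rangle$ does not admit a geometric model.
   Context: A birestriction monoid is an algebra $(S;\cdot,{}^*,{}^+,1)$ such that $(S;\cdot,1)$ is a monoid and for all $x,y$: $xx^*=x$, $x^*y^*=y^*x^*$, $(xy^* )^*=x^*y^*$, $x^*y=y(xy)^*$; $x^+x=x$, $x^+y^+=y^+x^+$, $(x^+y)^+=x^+y^+$, $xy^+=(xy)^+x$; $(x^+)^*=x^+$, $(x^* )^+=x^*$. An inverse monoid is regarded as a birestriction monoid via $a^*=a^{-1}a$, $a^+=aa^{-1}$. An inverse monoid is $E$-unitary if $s\ge e$ with $e$ idempotent implies that $s$ is idempotent. $X^+$ is the free semigroup on $X$; $\overline{X^+}=\{\overline{u}:u\in X^+\}$ is a set disjoint from $X$ in bijection with $X^+$. $\mathrm{BRestr}\langle Y\mid R\rangle$ is the quotient of the free birestriction monoid on $Y$ by the congruence generated by $R$; a relation $a\ge b$ abbreviates $b=ab^*$ (equivalently $b=b^+a$). The sets of relations are $N_\varnothing=\{\overline{x}\ge x,\ \overline{uv}\ge\overline{u}\,\overline{v}: x\in X,\ u,v\in X^+\}$, $N_{ls}=\{\overline{x}\ge x,\ \overline{u}\,\overline{v}=\overline{u}^{\,+}\overline{uv}: x\in X,\ u,v\in X^+\}$, $N_{rs}=\{\overline{x}\ge x,\ \overline{u}\,\overline{v}=\overline{uv}\,\overline{v}^{\,*}: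 x\in X,\ u,v\in X^+\}$, $N_s=N_{ls}\cup N_{rs}$. A $Y$-generated birestriction monoid $S$ admits a geometric model if there is an injective $(2,1,1,0)$-morphism (preserving $\cdot,{}^*,{}^+,1$) from $S$ into a $Y$-generated $E$-unitary inverse monoid which is $Y$-canonical, i.e. commutes with the assignment maps from $Y$. Here $Y=X\cup\overline{X^+}$. *)

(* Defs.v *)
From HB Require Import structures.
From mathcomp Require Import all_boot.
From mathcomp Require Import boolp.

Set Implicit Arguments.
Unset Strict Implicit.
Unset Printing Implicit Defensive.
Set Warnings "-redundant-canonical-projection".

Local Open Scope group_scope.
Local Open Scope quotient_scope.

(* The (2,1,1,0)-signature, without axioms, on top of MathComp's [1] and [*]. *)
HB.mixin Record hasStarPlus S := { bstar : S -> S; bplus : S -> S }.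

#[short(type="birestrSigType")]
HB.structure Definition BirestrSig := {S of hasStarPlus S & ChoiceBaseUMagma S}.

(* [x ^+ n] is already the power in MathComp, hence the brackets. *)
Notation "x ^[*]" := (bstar x) (at level 2, left associativity, format "x ^[*]") :
  group_scope.
Notation "x ^[+]" := (bplus x) (at level 2, left associativity, format "x ^[+]") :
  group_scope.

HB.mixin Record isBirestriction S of BirestrSig S & Monoid S := {
  mul_star : forall x : S, x * x^[*] = x;
  starC : forall x y : S, x^[*] * y^[*] = y^[*] * x^[*];
  star_mul_star : forall x y : S, (x * y^[*])^[*] = x^[*] * y^[*];
  star_ample : forall x y : S, x^[*] * y = y * (x * y)^[*];
  plus_mul : forall x : S, x^[+] * x = x;
  plusC : forall x y : S, x^[+] * y^[+] = y^[+] * x^[+];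
  plus_plus_mul : forall x y : S, (x^[+] * y)^[+] = x^[+] * y^[+];
  plus_ample : forall x y : S, x * y^[+] = (x * y)^[+] * x;
  star_plus : forall x : S, x^[+]^[*] = x^[+];
  plus_star : forall x : S, x^[*]^[+] = x^[*]
}.

#[short(type="birestrType")]
HB.structure Definition BirestrMonoid :=
  {S of isBirestriction S & BirestrSig S & Monoid S}.

Record birestr_morphism (S T : birestrSigType) (f : S -> T) : Prop := {
  bmorph1 : f 1 = 1;
  bmorphM : forall x y, f (x * y) = f x * f y;
  bmorph_star : forall x, f x^[*] = (f x)^[*];
  bmorph_plus : forall x, f x^[+] = (f x)^[+]
}.

Definition natural_ge (S : birestrSigType) (a b : S) : Prop := b = a * b^[*].

Lemma natural_geE (S : birestrType) (a b : S) :
  natural_ge a b <-> b = b^[+] * a.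
Proof.
rewrite /natural_ge; split=> h.
  by rewrite {2}h -plus_ample plus_star -h.
by rewrite {2}h -star_ample star_plus -h.
Qed.

Record congruence (S : birestrSigType) (e : S -> S -> Prop) : Prop := {
  cong_refl : forall x, e x x;
  cong_sym : forall x y, e x y -> e y x;
  cong_trans : forall x y z, e x y -> e y z -> e x z;
  cong_mul : forall x x' y y', e x x' -> e y y' -> e (x * y) (x' * y');
  cong_star : forall x x', e x x' -> e x^[*] x'^[*];
  cong_plus : forall x x', e x x' -> e x^[+] x'^[+]
}.

Definition cong_gen (S : birestrSigType) (R : S -> S -> Prop) (x y : S) : Prop :=
  forall e : S -> S -> Prop, congruence e -> (forall a b, R a b -> e a b) -> e x y.

Lemma cong_genP (S : birestrSigType) (R : S -> S -> Prop) :
  congruence (cong_gen R).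
Proof.
split.
- by move=> x e he _; exact: cong_refl.
- by move=> x y h e he hR; apply: (cong_sym he); exact: h.
- by move=> x y z h1 h2 e he hR; apply: (cong_trans he (h1 e he hR)); exact: h2.
- by move=> x x' y y' h1 h2 e he hR; apply: (cong_mul he); [exact: h1|exact: h2].
- by move=> x x' h e he hR; apply: (cong_star he); exact: h.
- by move=> x x' h e he hR; apply: (cong_plus he); exact: h.
Qed.

Lemma cong_gen_sub (S : birestrSigType) (R : S -> S -> Prop) a b :
  R a b -> cong_gen R a b.
Proof. by move=> h e _; apply. Qed.

Definition cong_rel (S : birestrSigType) (R : S -> S -> Prop) : rel S :=
  fun x y => `[< cong_gen R x y >].

Lemma cong_rel_equiv (S : birestrSigType) (R : S -> S -> Prop) :
  equiv_class_of (cong_rel R).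
Proof.
have C := cong_genP R; split.
- by move=> x; apply/asboolP; exact: cong_refl.
- by move=> x y; apply: asbool_equiv_eq; split; exact: cong_sym.
- by move=> y x z /asboolP h1 /asboolP h2; apply/asboolP; exact: cong_trans h1 h2.
Qed.

Canonical cong_equiv (S : birestrSigType) (R : S -> S -> Prop) :=
  EquivRelPack (cong_rel_equiv R).

Definition bquot (S : birestrSigType) (R : S -> S -> Prop) : Type :=
  {eq_quot (cong_equiv R)}.

HB.instance Definition _ (S : birestrSigType) (R : S -> S -> Prop) :=
  gen_eqMixin (bquot R).
HB.instance Definition _ (S : birestrSigType) (R : S -> S -> Prop) :=
  gen_choiceMixin (bquot R).

Definition bproj (S : birestrSigType) (R : S -> S -> Prop) (x : S) : bquot R :=
  \pi_{eq_quot (cong_equiv R)} x.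

Definition brepr (S : birestrSigType) (R : S -> S -> Prop) (q : bquot R) : S :=
  repr (q : {eq_quot (cong_equiv R)}).

Lemma breprK (S : birestrSigType) (R : S -> S -> Prop) (q : bquot R) :
  bproj R (brepr q) = q.
Proof. exact: reprK. Qed.

Lemma bproj_eq (S : birestrSigType) (R : S -> S -> Prop) (x y : S) :
  bproj R x = bproj R y <-> cong_gen R x y.
Proof.
split=> [h|h]; first by apply/asboolP; apply/(@eqquotP _ _ {eq_quot (cong_equiv R)}).
by apply/(@eqquotP _ _ {eq_quot (cong_equiv R)}); apply/asboolP.
Qed.

Section QuotientOps.
Variables (S : birestrSigType) (R : S -> S -> Prop).
HB.instance Definition _ := hasMul.Build (bquot R)
  (fun p q => bproj R (brepr p * brepr q)).
HB.instance Definition _ := hasOne.Build (bquot R) (bproj R 1).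
HB.instance Definition _ := hasStarPlus.Build (bquot R)
  (fun p => bproj R (brepr p)^[*]) (fun p => bproj R (brepr p)^[+]).

Lemma bproj_morphism : birestr_morphism (bproj R).
Proof.
have C := cong_genP R.
have rK x : cong_gen R x (brepr (bproj R x)).
  by apply/bproj_eq; rewrite breprK.
split=> // [x y|x|x]; apply/bproj_eq.
- by apply: (cong_mul C); exact: rK.
- by apply: (cong_star C); exact: rK.
- by apply: (cong_plus C); exact: rK.
Qed.

End QuotientOps.

Lemma bquot_ind (S : birestrSigType) (R : S -> S -> Prop) (P : bquot R -> Prop) :
  (forall x, P (bproj R x)) -> forall q, P q.
Proof. by move=> h q; rewrite -(breprK q). Qed.

(* The defining identities of birestriction monoids, as pairs of elements of an
   algebra that need not satisfy them. *)
Inductive birestr_identity (S : birestrSigType) : S -> S -> Prop :=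
| id_mulA x y z : birestr_identity (x * (y * z)) (x * y * z)
| id_mul1 x : birestr_identity (1 * x) x
| id_mulr1 x : birestr_identity (x * 1) x
| id_mul_star x : birestr_identity (x * x^[*]) x
| id_starC x y : birestr_identity (x^[*] * y^[*]) (y^[*] * x^[*])
| id_star_mul_star x y : birestr_identity (x * y^[*])^[*] (x^[*] * y^[*])
| id_star_ample x y : birestr_identity (x^[*] * y) (y * (x * y)^[*])
| id_plus_mul x : birestr_identity (x^[+] * x) x
| id_plusC x y : birestr_identity (x^[+] * y^[+]) (y^[+] * x^[+])
| id_plus_plus_mul x y : birestr_identity (x^[+] * y)^[+] (x^[+] * y^[+])
| id_plus_ample x y : birestr_identity (x * y^[+]) ((x * y)^[+] * x)
| id_star_plus x : birestr_identity x^[+]^[*] x^[+]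
| id_plus_star x : birestr_identity x^[*]^[+] x^[*].

Section QuotientIdentities.
Variables (S : birestrSigType) (R : S -> S -> Prop).
Hypothesis R_id : forall a b : S, birestr_identity a b -> cong_gen R a b.

Let pE := (bmorphM (bproj_morphism R), bmorph_star (bproj_morphism R),
           bmorph_plus (bproj_morphism R), bmorph1 (bproj_morphism R)).
Let pid (a b : S) (h : birestr_identity a b) : bproj R a = bproj R b :=
  proj2 (bproj_eq R a b) (R_id h).

Lemma bquot_mulA (x y z : bquot R) : x * (y * z) = x * y * z.
Proof.
elim/bquot_ind: x => x; elim/bquot_ind: y => y; elim/bquot_ind: z => z.
by have := pid (id_mulA x y z); rewrite !pE.
Qed.
Lemma bquot_mul1 (x : bquot R) : 1 * x = x.
Proof.
elim/bquot_ind: x => x.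
by have := pid (id_mul1 x); rewrite !pE.
Qed.
Lemma bquot_mulr1 (x : bquot R) : x * 1 = x.
Proof.
elim/bquot_ind: x => x.
by have := pid (id_mulr1 x); rewrite !pE.
Qed.
Lemma bquot_mul_star (x : bquot R) : x * x^[*] = x.
Proof.
elim/bquot_ind: x => x.
by have := pid (id_mul_star x); rewrite !pE.
Qed.
Lemma bquot_starC (x y : bquot R) : x^[*] * y^[*] = y^[*] * x^[*].
Proof.
elim/bquot_ind: x => x; elim/bquot_ind: y => y.
by have := pid (id_starC x y); rewrite !pE.
Qed.
Lemma bquot_star_mul_star (x y : bquot R) : (x * y^[*])^[*] = x^[*] * y^[*].
Proof.
elim/bquot_ind: x => x; elim/bquot_ind: y => y.
by have := pid (id_star_mul_star x y); rewrite !pE.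
Qed.
Lemma bquot_star_ample (x y : bquot R) : x^[*] * y = y * (x * y)^[*].
Proof.
elim/bquot_ind: x => x; elim/bquot_ind: y => y.
by have := pid (id_star_ample x y); rewrite !pE.
Qed.
Lemma bquot_plus_mul (x : bquot R) : x^[+] * x = x.
Proof.
elim/bquot_ind: x => x.
by have := pid (id_plus_mul x); rewrite !pE.
Qed.
Lemma bquot_plusC (x y : bquot R) : x^[+] * y^[+] = y^[+] * x^[+].
Proof.
elim/bquot_ind: x => x; elim/bquot_ind: y => y.
by have := pid (id_plusC x y); rewrite !pE.
Qed.
Lemma bquot_plus_plus_mul (x y : bquot R) : (x^[+] * y)^[+] = x^[+] * y^[+].
Proof.
elim/bquot_ind: x => x; elim/bquot_ind: y => y.
by have := pid (id_plus_plus_mul x y); rewrite !pE.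
Qed.
Lemma bquot_plus_ample (x y : bquot R) : x * y^[+] = (x * y)^[+] * x.
Proof.
elim/bquot_ind: x => x; elim/bquot_ind: y => y.
by have := pid (id_plus_ample x y); rewrite !pE.
Qed.
Lemma bquot_star_plus (x : bquot R) : x^[+]^[*] = x^[+].
Proof.
elim/bquot_ind: x => x.
by have := pid (id_star_plus x); rewrite !pE.
Qed.
Lemma bquot_plus_star (x : bquot R) : x^[*]^[+] = x^[*].
Proof.
elim/bquot_ind: x => x.
by have := pid (id_plus_star x); rewrite !pE.
Qed.

End QuotientIdentities.

Lemma birestr_identity_eq (S : birestrType) (a b : S) :
  birestr_identity a b -> a = b.
Proof.
case=> *; [exact: mulgA|exact: mul1g|exact: mulg1|exact: mul_star|exact: starC
  |exact: star_mul_star|exact: star_ample|exact: plus_mul|exact: plusC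
  |exact: plus_plus_mul|exact: plus_ample|exact: star_plus|exact: plus_star].
Qed.

Section QuotientMonoid.
Variables (S : birestrType) (R : S -> S -> Prop).

Let R_id (a b : S) : birestr_identity a b -> cong_gen R a b.
Proof. by move/birestr_identity_eq->; exact: cong_refl (cong_genP R) b. Qed.

HB.instance Definition _ :=
  Magma_isSemigroup.Build (bquot R) (bquot_mulA R_id).
HB.instance Definition _ :=
  BaseUMagma_isUMagma.Build (bquot R) (bquot_mul1 R_id) (bquot_mulr1 R_id).
HB.instance Definition _ := isBirestriction.Build (bquot R)
  (bquot_mul_star R_id) (bquot_starC R_id) (bquot_star_mul_star R_id)
  (bquot_star_ample R_id) (bquot_plus_mul R_id) (bquot_plusC R_id)
  (bquot_plus_plus_mul R_id) (bquot_plus_ample R_id) (bquot_star_plus R_id)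
  (bquot_plus_star R_id).

End QuotientMonoid.

Inductive bterm (Y : Type) : Type :=
| BVar of Y
| BOne
| BMul of bterm Y & bterm Y
| BStar of bterm Y
| BPlus of bterm Y.
Arguments BOne {Y}.

HB.instance Definition _ (Y : Type) := gen_eqMixin (bterm Y).
HB.instance Definition _ (Y : Type) := gen_choiceMixin (bterm Y).
HB.instance Definition _ (Y : Type) := hasMul.Build (bterm Y) (@BMul Y).
HB.instance Definition _ (Y : Type) := hasOne.Build (bterm Y) BOne.
HB.instance Definition _ (Y : Type) :=
  hasStarPlus.Build (bterm Y) (@BStar Y) (@BPlus Y).

Fixpoint beval (Y : Type) (S : birestrSigType) (f : Y -> S) (t : bterm Y) : S :=
  match t with
  | BVar y => f y
  | BOne => 1
  | BMul t u => beval f t * beval f u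
  | BStar t => (beval f t)^[*]
  | BPlus t => (beval f t)^[+]
  end.

Definition free_birestr (Y : Type) : Type :=
  bquot (@birestr_identity (bterm Y)).

HB.instance Definition _ (Y : Type) := BirestrSig.copy (free_birestr Y)
  (bquot (@birestr_identity (bterm Y))).

Section FreeMonoid.
Variable Y : Type.

Let R_id := @cong_gen_sub (bterm Y) (@birestr_identity (bterm Y)).

HB.instance Definition _ :=
  Magma_isSemigroup.Build (free_birestr Y) (bquot_mulA R_id).
HB.instance Definition _ :=
  BaseUMagma_isUMagma.Build (free_birestr Y) (bquot_mul1 R_id) (bquot_mulr1 R_id).
HB.instance Definition _ := isBirestriction.Build (free_birestr Y)
  (bquot_mul_star R_id) (bquot_starC R_id) (bquot_star_mul_star R_id)
  (bquot_star_ample R_id) (bquot_plus_mul R_id) (bquot_plusC R_id)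
  (bquot_plus_plus_mul R_id) (bquot_plus_ample R_id) (bquot_star_plus R_id)
  (bquot_plus_star R_id).

Definition free_gen (y : Y) : free_birestr Y :=
  bproj (@birestr_identity (bterm Y)) (BVar y).

Definition free_lift (S : birestrType) (f : Y -> S) (q : free_birestr Y) : S :=
  beval f (brepr q).

Lemma beval_free_lift (S : birestrType) (f : Y -> S) (t : bterm Y) :
  free_lift f (bproj (@birestr_identity (bterm Y)) t) = beval f t.
Proof.
have /bproj_eq h := breprK (bproj (@birestr_identity (bterm Y)) t).
apply: (h (fun a b => beval f a = beval f b)).
  split=> //=.
  - by move=> x y z ->.
  - by move=> x x' y y' /= -> ->.
  - by move=> x x' /= ->.
  - by move=> x x' /= ->.
move=> a b ab; apply: birestr_identity_eq; case: ab => *; constructor.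
Qed.

Lemma free_lift_morphism (S : birestrType) (f : Y -> S) :
  birestr_morphism (free_lift f).
Proof.
have [p1 pM pS pP] := bproj_morphism (@birestr_identity (bterm Y)).
split.
- exact: (beval_free_lift f BOne).
- elim/bquot_ind=> x; elim/bquot_ind=> y.
  transitivity (beval f (BMul x y)); last by rewrite /= -!beval_free_lift.
  rewrite -beval_free_lift; exact: (congr1 (free_lift f) (esym (pM x y))).
- elim/bquot_ind=> x.
  transitivity (beval f (BStar x)); last by rewrite /= -!beval_free_lift.
  rewrite -beval_free_lift; exact: (congr1 (free_lift f) (esym (pS x))).
- elim/bquot_ind=> x.
  transitivity (beval f (BPlus x)); last by rewrite /= -!beval_free_lift.
  rewrite -beval_free_lift; exact: (congr1 (free_lift f) (esym (pP x))).
Qed.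

Lemma free_lift_gen (S : birestrType) (f : Y -> S) (y : Y) :
  free_lift f (free_gen y) = f y.
Proof. exact: beval_free_lift. Qed.

End FreeMonoid.

(* Every subset containing the image of [a] and closed under the operations
   [1], [*], [^*], [^+] is the whole of [S]. *)
Definition birestr_generated (Y : Type) (S : birestrSigType) (a : Y -> S) : Prop :=
  forall P : S -> Prop,
    (forall y, P (a y)) -> P 1 -> (forall s t, P s -> P t -> P (s * t)) ->
    (forall s, P s -> P s^[*]) -> (forall s, P s -> P s^[+]) ->
    forall s, P s.

Record gen_birestr (Y : Type) := GenBirestr {
  gb_sort :> birestrType;
  gb_assign : Y -> gb_sort;
  gb_generated : birestr_generated gb_assign
}.

(* The monoid BRestr<Y | R>; a relation is a pair of elements of the free
   birestriction monoid. *)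
Section Presentation.
Variables (Y : Type) (R : free_birestr Y -> free_birestr Y -> Prop).

Definition presented_gen (y : Y) : bquot R := bproj R (free_gen y).

Lemma free_generated : birestr_generated (@free_gen Y).
Proof.
move=> P PY P1 PM PS PP; elim/bquot_ind.
have [p1 pM pS pP] := bproj_morphism (@birestr_identity (bterm Y)).
elim=> [y||t Pt u Pu|t Pt|t Pt]; first exact: PY.
- exact: P1.
- exact: (eq_ind_r P (PM _ _ Pt Pu) (pM t u)).
- exact: (eq_ind_r P (PS _ Pt) (pS t)).
- exact: (eq_ind_r P (PP _ Pt) (pP t)).
Qed.

Lemma presented_generated : birestr_generated presented_gen.
Proof.
have [p1 pM pS pP] := bproj_morphism R.
move=> P PY P1 PM PS PP; elim/bquot_ind.
apply: (free_generated (P := fun x => P (bproj R x))) => //.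
- by move=> s t Ps Pt; rewrite pM; exact: PM.
- by move=> s Ps; rewrite pS; exact: PS.
- by move=> s Ps; rewrite pP; exact: PP.
Qed.

Definition presented : gen_birestr Y := GenBirestr presented_generated.

End Presentation.

(* MathComp's star monoids come with an involutive anti-automorphism [^-1]; in an
   inverse monoid this holds automatically, see the factory [Monoid_isInverse]. *)
HB.mixin Record isInverse M of StarMonoid M := {
  mulgVg : forall x : M, x * x^-1 * x = x;
  inverse_unique : forall x y : M, x * y * x = x -> y * x * y = y -> y = x^-1
}.

#[short(type="inverseMonoidType")]
HB.structure Definition InverseMonoid := {M of isInverse M & StarMonoid M}.

Section UniqueInverses.
Variables (M : monoidType) (inv : M -> M).
Hypothesis mVm : forall x, x * inv x * x = x.
Hypothesis VmV : forall x, inv x * x * inv x = inv x.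
Hypothesis uniq_inv : forall x y, x * y * x = x -> y * x * y = y -> y = inv x.
Implicit Types x y e f : M.

Lemma uinvK : involutive inv.
Proof. by move=> x; symmetry; apply: uniq_inv. Qed.

Lemma uinv_idem e : e * e = e -> inv e = e.
Proof. by move=> ee; symmetry; apply: uniq_inv; rewrite !ee. Qed.

Lemma uinv_idem_mul e f : e * e = e -> f * f = f -> e * f * (e * f) = e * f.
Proof.
move=> ee ff; set x := inv (e * f).
have h1 : e * f * x * (e * f) = e * f by exact: mVm.
have h2 : x * (e * f) * x = x by exact: VmV.
have xE : f * x * e = x.
  apply: uniq_inv.
    have -> : e * f * (f * x * e) * (e * f) = e * (f * f) * x * ((e * e) * f).
      by rewrite !mulgA.
    by rewrite ff ee.
  have -> : f * x * e * (e * f) * (f * x * e) = f * (x * ((e * e) * (f * f)) * x) * e.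
    by rewrite !mulgA.
  by rewrite ee ff h2.
have xx : x * x = x.
  rewrite -[in LHS]xE.
  have -> : f * x * e * (f * x * e) = f * (x * (e * f) * x) * e by rewrite !mulgA.
  by rewrite h2.
by have := uinv_idem xx; rewrite /x uinvK => efE; rewrite {2}efE -/x {1}efE -/x xx.
Qed.

Lemma uinv_idemC e f : e * e = e -> f * f = f -> e * f = f * e.
Proof.
move=> ee ff; have hef := uinv_idem_mul ee ff; have hfe := uinv_idem_mul ff ee.
rewrite -(uinv_idem hfe); apply: uniq_inv.
  have -> : f * e * (e * f) * (f * e) = f * (e * e) * (f * f) * e by rewrite !mulgA.
  by rewrite ee ff -[RHS]hfe !mulgA.
have -> : e * f * (f * e) * (e * f) = e * (f * f) * (e * e) * f by rewrite !mulgA.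
by rewrite ee ff -[RHS]hef !mulgA.
Qed.

Lemma uinvM : {morph inv : x y / x * y >-> y * x}.
Proof.
move=> x y.
have C : inv x * x * (y * inv y) = y * inv y * (inv x * x).
  by apply: uinv_idemC; rewrite mulgA ?mVm ?VmV.
symmetry; apply: uniq_inv.
  have -> : x * y * (inv y * inv x) * (x * y) = x * (y * inv y * (inv x * x)) * y.
    by rewrite !mulgA.
  rewrite -C.
  have -> : x * (inv x * x * (y * inv y)) * y = (x * inv x * x) * (y * inv y * y).
    by rewrite !mulgA.
  by rewrite !mVm.
have -> : inv y * inv x * (x * y) * (inv y * inv x)
        = inv y * (inv x * x * (y * inv y)) * inv x by rewrite !mulgA.
rewrite C.
have -> : inv y * (y * inv y * (inv x * x)) * inv x
        = (inv y * y * inv y) * (inv x * x * inv x) by rewrite !mulgA.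
by rewrite !VmV.
Qed.

End UniqueInverses.

(* The textbook definition: every element has a unique inverse. *)
HB.factory Record Monoid_isInverse M of Monoid M := {
  inverse : M -> M;
  mul_inverse_mul : forall x : M, x * inverse x * x = x;
  inverse_mul_inverse : forall x : M, inverse x * x * inverse x = inverse x;
  inverse_uniq : forall x y : M, x * y * x = x -> y * x * y = y -> y = inverse x
}.

HB.builders Context M of Monoid_isInverse M.

HB.instance Definition _ := hasInv.Build M inverse.
HB.instance Definition _ := Monoid_isStarMonoid.Build M
  (uinvK mul_inverse_mul inverse_mul_inverse inverse_uniq)
  (uinvM mul_inverse_mul inverse_mul_inverse inverse_uniq).
HB.instance Definition _ := isInverse.Build M mul_inverse_mul inverse_uniq.

HB.end.

Section InverseMonoidTheory.
Variable M : inverseMonoidType.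
Implicit Types x y e f : M.

Lemma mulVgV x : x^-1 * x * x^-1 = x^-1.
Proof. by rewrite -{2}[x]invgK mulgVg. Qed.

Lemma inv_idem e : e * e = e -> e^-1 = e.
Proof. exact: (uinv_idem (@inverse_unique M)). Qed.

Lemma idemC e f : e * e = e -> f * f = f -> e * f = f * e.
Proof. exact: (uinv_idemC (@mulgVg M) mulVgV (@inverse_unique M)). Qed.

Lemma idem_mulgV x : x * x^-1 * (x * x^-1) = x * x^-1.
Proof. by rewrite mulgA mulgVg. Qed.

Lemma idem_mulVg x : x^-1 * x * (x^-1 * x) = x^-1 * x.
Proof. by rewrite mulgA mulVgV. Qed.

End InverseMonoidTheory.

Definition birestr_of (M : inverseMonoidType) : Type := M.

HB.instance Definition _ (M : inverseMonoidType) := InverseMonoid.copy (birestr_of M) M.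
HB.instance Definition _ (M : inverseMonoidType) :=
  hasStarPlus.Build (birestr_of M) (fun a => a^-1 * a) (fun a => a * a^-1).

Section InverseIsBirestriction.
Variable M : inverseMonoidType.
Notation B := (birestr_of M).
Implicit Types x y : B.

Let st x : x^[*] = x^-1 * x. Proof. by []. Qed.
Let pl x : x^[+] = x * x^-1. Proof. by []. Qed.

Let stI x : (x^[*])^-1 = x^[*].
Proof. exact: inv_idem (idem_mulVg x). Qed.
Let plI x : (x^[+])^-1 = x^[+].
Proof. exact: inv_idem (idem_mulgV x). Qed.
Let stst x : x^[*] * x^[*] = x^[*].
Proof. exact: idem_mulVg. Qed.
Let plpl x : x^[+] * x^[+] = x^[+].
Proof. exact: idem_mulgV. Qed.

Let ax1 x : x * x^[*] = x.
Proof. by rewrite st mulgA mulgVg. Qed.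
Let ax2 x y : x^[*] * y^[*] = y^[*] * x^[*].
Proof. exact: idemC (stst x) (stst y). Qed.
Let ax3 x y : (x * y^[*])^[*] = x^[*] * y^[*].
Proof.
rewrite [LHS]st invgM stI.
have -> : y^[*] * x^-1 * (x * y^[*]) = y^[*] * x^[*] * y^[*] by rewrite st !mulgA.
by rewrite (ax2 y x) -mulgA stst.
Qed.
Let ax4 x y : x^[*] * y = y * (x * y)^[*].
Proof.
rewrite [(x * y)^[*]]st invgM.
have -> : y * (y^-1 * x^-1 * (x * y)) = y^[+] * x^[*] * y by rewrite st pl !mulgA.
have yy : y^[+] * y = y := mulgVg (y : M).
have C : y^[+] * x^[*] = x^[*] * y^[+] := idemC (plpl y) (stst x).
by rewrite C -(mulgA x^[*]) yy.
Qed.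
Let ax5 x : x^[+] * x = x.
Proof. exact: mulgVg. Qed.
Let ax6 x y : x^[+] * y^[+] = y^[+] * x^[+].
Proof. exact: idemC (plpl x) (plpl y). Qed.
Let ax7 x y : (x^[+] * y)^[+] = x^[+] * y^[+].
Proof.
rewrite [LHS]pl invgM plI.
have -> : x^[+] * y * (y^-1 * x^[+]) = x^[+] * y^[+] * x^[+] by rewrite (pl y) !mulgA.
by rewrite -mulgA (ax6 y x) mulgA plpl.
Qed.
Let ax8 x y : x * y^[+] = (x * y)^[+] * x.
Proof.
rewrite [(x * y)^[+]]pl invgM.
have -> : x * y * (y^-1 * x^-1) * x = x * (y^[+] * x^[*]) by rewrite st pl !mulgA.
have C : y^[+] * x^[*] = x^[*] * y^[+] := idemC (plpl y) (stst x).
by rewrite C (mulgA x x^[*]) ax1.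
Qed.
Let ax9 x : x^[+]^[*] = x^[+].
Proof. by rewrite [LHS]st plI plpl. Qed.
Let ax10 x : x^[*]^[+] = x^[*].
Proof. by rewrite [LHS]pl stI stst. Qed.

HB.instance Definition _ :=
  isBirestriction.Build B ax1 ax2 ax3 ax4 ax5 ax6 ax7 ax8 ax9 ax10.

End InverseIsBirestriction.

Definition E_unitary (M : inverseMonoidType) : Prop :=
  forall s e : birestr_of M, e * e = e -> natural_ge s e -> s * s = s.

Definition inverse_generated (Y : Type) (M : inverseMonoidType) (a : Y -> M) : Prop :=
  forall P : M -> Prop,
    (forall y, P (a y)) -> P 1 -> (forall s t, P s -> P t -> P (s * t)) ->
    (forall s, P s -> P s^-1) ->
    forall s, P s.

Record gen_inverse (Y : Type) := GenInverse {
  gi_sort :> inverseMonoidType;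
  gi_assign : Y -> gi_sort;
  gi_generated : inverse_generated gi_assign
}.

Definition admits_geometric_model (Y : Type) (S : gen_birestr Y) : Prop :=
  exists (M : gen_inverse Y) (phi : S -> birestr_of M),
    [/\ E_unitary M, injective phi, birestr_morphism phi &
        forall y, phi (gb_assign S y) = gi_assign M y].

Definition free_semigroup (X : Type) : Type := {w : seq X | ~~ nilp w}.

Definition letter (X : Type) (x : X) : free_semigroup X :=
  exist _ [:: x] isT.

Fact cat_nilpN (X : Type) (u v : free_semigroup X) : ~~ nilp (val u ++ val v).
Proof. by case: u => -[|x u]. Qed.

HB.instance Definition _ (X : Type) := gen_eqMixin (free_semigroup X).
HB.instance Definition _ (X : Type) := gen_choiceMixin (free_semigroup X).

Section FreeSemigroup.
Variable X : Type.
Let fmul (u v : free_semigroup X) : free_semigroup X :=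
  exist _ (val u ++ val v) (cat_nilpN u v).
Let fmulA : associative fmul.
Proof. by move=> u v w; apply: val_inj; rewrite /= catA. Qed.
HB.instance Definition _ := isSemigroup.Build (free_semigroup X) fmulA.
End FreeSemigroup.

(* The generating set: the disjoint union of [X] and a copy of [X^+]. *)
Definition gens (X : Type) : Type := (X + free_semigroup X)%type.

Definition gen_letter (X : Type) (x : X) : free_birestr (gens X) :=
  free_gen (inl x).
Definition bar (X : Type) (u : free_semigroup X) : free_birestr (gens X) :=
  free_gen (inr u).

Variant N_index := i_empty | i_ls | i_rs | i_s.

(* The relation a >= b is the pair (b, a b^* ). *)
Inductive N_empty (X : Type) : free_birestr (gens X) -> free_birestr (gens X) -> Prop :=
| N_empty_letter x :
    N_empty (gen_letter x) (bar (letter x) * (gen_letter x)^[*])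
| N_empty_mul u v :
    N_empty (bar u * bar v) (bar (u * v) * (bar u * bar v)^[*]).

Inductive N_ls (X : Type) : free_birestr (gens X) -> free_birestr (gens X) -> Prop :=
| N_ls_letter x :
    N_ls (gen_letter x) (bar (letter x) * (gen_letter x)^[*])
| N_ls_mul u v :
    N_ls (bar u * bar v) ((bar u)^[+] * bar (u * v)).

Inductive N_rs (X : Type) : free_birestr (gens X) -> free_birestr (gens X) -> Prop :=
| N_rs_letter x :
    N_rs (gen_letter x) (bar (letter x) * (gen_letter x)^[*])
| N_rs_mul u v :
    N_rs (bar u * bar v) (bar (u * v) * (bar v)^[*]).

Definition N_s (X : Type) (a b : free_birestr (gens X)) : Prop :=
  N_ls a b \/ N_rs a b.

Definition N_rel (X : Type) (i : N_index) :
    free_birestr (gens X) -> free_birestr (gens X) -> Prop :=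
  match i with
  | i_empty => @N_empty X
  | i_ls => @N_ls X
  | i_rs => @N_rs X
  | i_s => @N_s X
  end.

Definition F_ (X : Type) (i : N_index) : gen_birestr (gens X) := presented (@N_rel X i).

(* Main.v *)
Require Import Defs.
From HB Require Import structures.
From mathcomp Require Import all_boot.
From mathcomp Require Import boolp.

(** For distinct letters [x], [y] the word
      [t = bar(xx) bar(yx)^-1 bar(yy) bar(xy)^-1]
    labels a square of the Cayley graph of the free group. In any inverse monoid
    satisfying the relations, [t] lies above
      [bar x bar x (bar y bar x)^-1 bar y bar y (bar x bar y)^-1 = bar x f bar x^-1]
    with [f] idempotent, so under E-unitarity [t] is idempotent and
    [t t^-1 <= bar(xy)^+]. The projection [t t^-1] is the value of a birestriction
    term, but the inequality fails in the birestriction monoid itself: unfold the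
    square into a path with five vertices and let the generators act on it by partial
    bijections. Two of its edges are never composable, and edges with a common
    endpoint have distinct labels of the same length 2, so all the relations hold
    trivially; the two end points, identified by E-unitarity, are now distinct. *)

Set Implicit Arguments.
Unset Strict Implicit.
Unset Printing Implicit Defensive.

Local Open Scope group_scope.

(** * The natural order and multiplication *)

Section NaturalOrder.
Variable S : birestrType.
Implicit Types a b c d : S.

Lemma natural_ge_mul_star a b : natural_ge a (a * b^[*]).
Proof. by rewrite /natural_ge star_mul_star mulgA mul_star. Qed.

(** [star_ample] moves [b^[*]] to the right across [c], so that [b * d] becomes [a * c] times a
    projection. *)
Lemma natural_ge_mul a b c d :
  natural_ge a b -> natural_ge c d -> natural_ge (a * c) (b * d).
Proof.
move=> ab cd.
have -> : b * d = a * c * (b * c * d^[*])^[*].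
  rewrite (star_mul_star (b * c)) [in LHS]cd [in LHS]ab !mulgA.
  by rewrite -(mulgA a b^[*]) star_ample !mulgA.
exact: natural_ge_mul_star.
Qed.

Lemma natural_ge_plus_mul a b : natural_ge a (b^[+] * a).
Proof. by apply/natural_geE; rewrite plus_plus_mul -mulgA plus_mul. Qed.

End NaturalOrder.

Lemma bmorph_natural_ge (S T : birestrSigType) (f : S -> T) (a b : S) :
  birestr_morphism f -> natural_ge a b -> natural_ge (f a) (f b).
Proof.
by move=> fm; rewrite /natural_ge => {1}->; rewrite (bmorphM fm) (bmorph_star fm).
Qed.

(** * The square in an E-unitary inverse monoid *)

Section InverseMonoids.
Variable M : inverseMonoidType.
Implicit Types a b c d x y : birestr_of M.

Lemma natural_ge_inv a b : natural_ge a b -> natural_ge a^-1 b^-1.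
Proof.
move/natural_geE => ab; rewrite /natural_ge.
have -> : (b^-1)^[*] = b^[+] by rewrite /bstar /bplus /= invgK.
by rewrite {1}ab invgM (inv_idem (idem_mulgV (b : M))).
Qed.

Lemma plus_mul_starE a b : (a * b^[*])^[+] = a * b^[*] * a^-1.
Proof.
have bb : b^[*] * b^[*] = b^[*] := idem_mulVg (b : M).
have -> : (a * b^[*])^[+] = a * b^[*] * (a * b^[*])^-1 by [].
by move: b^[*] bb => e ee; rewrite invgM (inv_idem ee) !mulgA -(mulgA a) ee.
Qed.

Lemma star_plus_mulE a b : (b^[+] * a)^[*] = a^-1 * b^[+] * a.
Proof.
have bb : b^[+] * b^[+] = b^[+] := idem_mulgV (b : M).
have -> : (b^[+] * a)^[*] = (b^[+] * a)^-1 * (b^[+] * a) by [].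
by move: b^[+] bb => e ee; rewrite invgM (inv_idem ee) !mulgA -(mulgA a^-1) ee.
Qed.

Lemma conj_idem a e : e * e = e -> a * e * a^-1 * (a * e * a^-1) = a * e * a^-1.
Proof.
move=> ee; have aa : a^-1 * a * (a^-1 * a) = a^-1 * a := idem_mulVg (a : M).
have -> : a * e * a^-1 * (a * e * a^-1) = a * (e * (a^-1 * a)) * e * a^-1.
  by rewrite !mulgA.
rewrite (idemC ee aa).
have -> : a * (a^-1 * a * e) * e * a^-1 = a * a^-1 * a * (e * e) * a^-1.
  by rewrite !mulgA.
by rewrite ee mulgVg.
Qed.

(** For partial bijections composed from left to right, this is the identity on the points where a
    path begins that follows [a], then [b] backwards, [c], and [d] backwards. *)
Definition square_proj (S : birestrSigType) (a b c d : S) : S :=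
  (a * ((c * d^[*])^[+] * b)^[*])^[+].

Lemma square_projE a b c d :
  let t := a * b^-1 * c * d^-1 in square_proj a b c d = t * t^-1.
Proof.
rewrite /square_proj /= plus_mul_starE star_plus_mulE plus_mul_starE.
by rewrite !invgM !invgK /bstar /= !mulgA.
Qed.

Lemma E_unitary_square x y a b c d : E_unitary M ->
  natural_ge a (x * x) -> natural_ge b (y * x) ->
  natural_ge c (y * y) -> natural_ge d (x * y) ->
  d^[+] * square_proj a b c d = square_proj a b c d.
Proof.
move=> EM ax bx cy dy; rewrite square_projE /=; set t := a * b^-1 * c * d^-1.
set s := x * x * (y * x)^-1 * (y * y) * (x * y)^-1.
have ts : natural_ge t s.
  apply: natural_ge_mul; last exact: natural_ge_inv.
  apply: natural_ge_mul => //; apply: natural_ge_mul => //.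
  exact: natural_ge_inv.
have ss : s * s = s.
  (* Once the inverses of products are expanded, [s] is a conjugate of a product of three commuting
     idempotents. *)
  have -> : s = x * (x * x^-1 * (y^-1 * y * (y * y^-1))) * x^-1.
    by rewrite /s !invgM !mulgA.
  have xI : x * x^-1 * (x * x^-1) = x * x^-1 := idem_mulgV (x : M).
  have yI : y * y^-1 * (y * y^-1) = y * y^-1 := idem_mulgV (y : M).
  have yJ : y^-1 * y * (y^-1 * y) = y^-1 * y := idem_mulVg (y : M).
  have idM (e f : M) : e * e = e -> f * f = f -> e * f * (e * f) = e * f.
    by move=> ee ff; rewrite mulgA -(mulgA e) (idemC ff ee) mulgA ee -mulgA ff.
  by apply: conj_idem; apply: (idM) => //; exact: (idM).
have tt : t * t = t := EM t s ss ts.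
have tV : t^-1 = t := inv_idem tt.
(* The swap is useful because [t^-1] begins with [d], which absorbs [d^[+]]. *)
have -> : t * t^-1 = t^-1 * t by rewrite tV.
have -> : t^-1 * t = d * (c^-1 * b * a^-1 * t).
  by rewrite {1}/t !invgM !invgK !mulgA.
by rewrite mulgA plus_mul.
Qed.

End InverseMonoids.

(** * The birestriction monoid of partial bijections *)

Record pbij (T : Type) := Pbij {
  pb_rel :> T -> T -> Prop;
  pb_fun : forall a b b', pb_rel a b -> pb_rel a b' -> b = b';
  pb_inj : forall a a' b, pb_rel a b -> pb_rel a' b -> a = a'
}.

HB.instance Definition _ (T : Type) := gen_eqMixin (pbij T).
HB.instance Definition _ (T : Type) := gen_choiceMixin (pbij T).

Section PartialBijections.
Variable T : Type.
Implicit Types r s t : pbij T.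

Lemma pbij_eq r s : (forall a b, r a b <-> s a b) -> r = s.
Proof.
case: r s => [r rf ri] [s sf si] /= rs.
have e : r = s by apply/funext => a; apply/funext => b; exact/propext.
by case: _ / e sf si rs => sf si _; congr Pbij; exact: Prop_irrelevance.
Qed.

Local Obligation Tactic := idtac.

Program Definition pb_one : pbij T := @Pbij T (fun a b => a = b) _ _.
Next Obligation. by move=> a b b' ->. Qed.
Next Obligation. by move=> a a' b ->. Qed.
(** Products act from left to right; hence [pb_star] below is the identity on the image and
    [pb_plus] the identity on the domain. *)
Program Definition pb_mul r s : pbij T :=
  @Pbij T (fun a b => exists2 c, r a c & s c b) _ _.
Next Obligation.
move=> r s a b b' [c rc sc] [c' rc' sc'].
by rewrite (pb_fun rc rc') in sc; exact: pb_fun sc sc'.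
Qed.
Next Obligation.
move=> r s a a' b [c rc sc] [c' rc' sc'].
by rewrite (pb_inj sc sc') in rc; exact: pb_inj rc rc'.
Qed.
Program Definition pb_star r : pbij T :=
  @Pbij T (fun a b => a = b /\ exists c, r c a) _ _.
Next Obligation. by move=> r a b b' [-> _] []. Qed.
Next Obligation. by move=> r a a' b [-> _] []. Qed.
Program Definition pb_plus r : pbij T :=
  @Pbij T (fun a b => a = b /\ exists c, r a c) _ _.
Next Obligation. by move=> r a b b' [-> _] []. Qed.
Next Obligation. by move=> r a a' b [-> _] []. Qed.

HB.instance Definition _ := hasMul.Build (pbij T) pb_mul.
HB.instance Definition _ := hasOne.Build (pbij T) pb_one.
HB.instance Definition _ := hasStarPlus.Build (pbij T) pb_star pb_plus.

Let pb_mulA : associative pb_mul.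
Proof. move=> r s t; apply: pbij_eq => a b /=; firstorder. Qed.
Let pb_mul1 : left_id pb_one pb_mul.
Proof. by move=> r; apply: pbij_eq => a b /=; split=> [[c ->]|] //; exists a. Qed.
Let pb_mulr1 : right_id pb_one pb_mul.
Proof. by move=> r; apply: pbij_eq => a b /=; split=> [[c ? <-]|] //; exists b. Qed.

HB.instance Definition _ := Magma_isSemigroup.Build (pbij T) pb_mulA.
HB.instance Definition _ := BaseUMagma_isUMagma.Build (pbij T) pb_mul1 pb_mulr1.

Let ax1 r : pb_mul r (pb_star r) = r.
Proof.
apply: pbij_eq => a b /=; split=> [[c h [<- _]] //|h].
by exists b => //; split=> //; exists a.
Qed.
Let ax2 r s : pb_mul (pb_star r) (pb_star s) = pb_mul (pb_star s) (pb_star r).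
Proof.
apply: pbij_eq => a b /=.
by split=> -[c [<- hc] [<- hc']]; exists a.
Qed.
Let ax3 r s : pb_star (pb_mul r (pb_star s)) = pb_mul (pb_star r) (pb_star s).
Proof.
apply: pbij_eq => a b /=; split.
  by case=> <- [c [d rd [<- sd]]]; exists d => //; split=> //; exists c.
by case=> c [<- [d rd]] [<- hs]; split=> //; exists d; exists a.
Qed.
Let ax4 r s : pb_mul (pb_star r) s = pb_mul s (pb_star (pb_mul r s)).
Proof.
apply: pbij_eq => a b /=; split.
  by case=> c [<- [d rd]] sb; exists b => //; split=> //; exists d; exists a.
case=> c sc [<- [d [e re se]]]; exists a => //; split=> //.
by exists d; rewrite (pb_inj sc se).
Qed.
Let ax5 r : pb_mul (pb_plus r) r = r.
Proof.
apply: pbij_eq => a b /=; split=> [[c [<- _]] //|h].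
by exists a => //; split=> //; exists b.
Qed.
Let ax6 r s : pb_mul (pb_plus r) (pb_plus s) = pb_mul (pb_plus s) (pb_plus r).
Proof.
apply: pbij_eq => a b /=.
by split=> -[c [<- hc] [<- hc']]; exists a.
Qed.
Let ax7 r s : pb_plus (pb_mul (pb_plus r) s) = pb_mul (pb_plus r) (pb_plus s).
Proof.
apply: pbij_eq => a b /=; split.
  by case=> <- [c [d [<- hr] sc]]; exists a => //; split=> //; exists c.
by case=> c [<- hr] [<- [d sd]]; split=> //; exists d; exists a.
Qed.
Let ax8 r s : pb_mul r (pb_plus s) = pb_mul (pb_plus (pb_mul r s)) r.
Proof.
apply: pbij_eq => a b /=; split.
  by case=> c rc [<- [d sd]]; exists a => //; split=> //; exists d; exists c.
case=> c [<- [d [e re se]]] rb; exists b => //; split=> //.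
by exists d; rewrite (pb_fun rb re).
Qed.
Let ax9 r : pb_star (pb_plus r) = pb_plus r.
Proof.
apply: pbij_eq => a b /=; split; first by case=> <- [c [<- h]].
by case=> <- h; split=> //; exists a.
Qed.
Let ax10 r : pb_plus (pb_star r) = pb_star r.
Proof.
apply: pbij_eq => a b /=; split; first by case=> <- [c [_ h]].
by case=> <- h; split=> //; exists a.
Qed.

HB.instance Definition _ :=
  isBirestriction.Build (pbij T) ax1 ax2 ax3 ax4 ax5 ax6 ax7 ax8 ax9 ax10.

End PartialBijections.

(** * The action of the generators on the unfolded square *)

Inductive vertex := P0 | C0 | P1 | C1 | P2.

Section Path.
Variables (X : Type) (x y : X).
Hypothesis xy : x <> y.

(** The path is [P0 -> C0 <- P1 -> C1 <- P2]; closing the square would identify [P0] with [P2]. *)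
Definition edge (w : seq X) (a b : vertex) : Prop :=
  match a, b with
  | P0, C0 => w = [:: x; x]
  | P1, C0 => w = [:: y; x]
  | P1, C1 => w = [:: y; y]
  | P2, C1 => w = [:: x; y]
  | _, _ => False
  end.

(** Only [P1] has two outgoing edges, and their labels differ in the second letter. In [edge_inj]
    the two edges into [C0], or into [C1], differ in the first letter. *)
Lemma edge_fun w a b b' : edge w a b -> edge w a b' -> b = b'.
Proof. by case: a; case: b; case: b' => //= -> [] // /esym. Qed.

Lemma edge_inj w a a' b : edge w a b -> edge w a' b -> a = a'.
Proof. by case: b; case: a; case: a' => //= -> [] // /esym. Qed.

Lemma edge_size w a b : edge w a b -> size w = 2.
Proof. by case: a; case: b => //= ->. Qed.

Lemma edge_not_composable v w a b c : edge v a b -> edge w b c -> False.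
Proof. by case: a; case: b; case: c. Qed.

Definition path_edges (w : seq X) : pbij vertex := Pbij (@edge_fun w) (@edge_inj w).

Local Obligation Tactic := idtac.

Program Definition pb_empty : pbij vertex := @Pbij vertex (fun _ _ => False) _ _.
Next Obligation. by []. Qed.
Next Obligation. by []. Qed.

(** Letters act as the empty map, which lies below every partial bijection, so the relations for
    letters hold. *)
Definition path_assign (g : gens X) : pbij vertex :=
  match g with inl _ => pb_empty | inr u => path_edges (val u) end.

Lemma path_letter z :
  path_assign (inl z) = path_assign (inr (letter z)) * (path_assign (inl z))^[*].
Proof. by apply: pbij_eq => a b /=; split=> // -[c _ [_ []]]. Qed.

Lemma path_mul u v : path_assign (inr u) * path_assign (inr v) = pb_empty.
Proof. by apply: pbij_eq => a b /=; split=> // -[c h /(edge_not_composable h)]. Qed.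

(** A point in this domain would force both [u] and [u * v] to have length 2, although [v] is
    nonempty; [path_rs] is dual. *)
Lemma path_ls u v : (path_assign (inr u))^[+] * path_assign (inr (u * v)) = pb_empty.
Proof.
apply: pbij_eq => a b /=; split=> // -[c [_ [d /edge_size hu]]] /edge_size.
by rewrite size_cat hu; case: (v) => -[].
Qed.

Lemma path_rs u v : path_assign (inr (u * v)) * (path_assign (inr v))^[*] = pb_empty.
Proof.
apply: pbij_eq => a b /=; split=> // -[c /edge_size huv [_ [d /edge_size hv]]].
by move: huv; rewrite size_cat hv addnC; case: (u) => -[].
Qed.

Lemma path_empty u v :
  path_assign (inr (u * v)) * (path_assign (inr u) * path_assign (inr v))^[*]
    = pb_empty.
Proof. by rewrite path_mul; apply: pbij_eq => a b /=; split=> // -[c _ [_ []]]. Qed.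

Lemma path_N_rel i a b :
  N_rel i a b -> free_lift path_assign a = free_lift path_assign b.
Proof.
have [_ fM fS fP] := free_lift_morphism path_assign.
case: i => [[z|u v]|[z|u v]|[z|u v]|[[z|u v]|[z|u v]]];
  rewrite !(fM, fS, fP) !free_lift_gen;
  by [exact: path_letter | rewrite path_empty path_mul
     | rewrite path_ls path_mul | rewrite path_rs path_mul].
Qed.

Definition word2 (z z' : X) : free_semigroup X := letter z * letter z'.

Lemma path_square_proj :
  let p z z' := path_assign (inr (word2 z z')) in
  let e := square_proj (p x x) (p y x) (p y y) (p x y) in
  (p x y)^[+] * e <> e.
Proof.
move=> p e eE.
have : pb_rel e P0 P0.
  (* The witnesses trace the whole path from [P0] to [P2]. *)
  split=> //; exists C0; exists C0 => //; split=> //; exists P1; exists P1 => //.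
  by split=> //; exists C1; exists C1 => //; split=> //; exists P2.
(* An edge labelled [xy] would now have to start at [P0], whose only edge is labelled [xx]. *)
rewrite -eE => -[c [_ [d]]] /=.
by case: d => // -[] /esym.
Qed.

End Path.

(** * Transfer between the presented monoid and its images *)

Lemma presented_eq_lift (Y : Type) (R : free_birestr Y -> free_birestr Y -> Prop)
    (S : birestrType) (f : Y -> S) (a b : free_birestr Y) :
  (forall c d, R c d -> free_lift f c = free_lift f d) ->
  bproj R a = bproj R b -> free_lift f a = free_lift f b.
Proof.
have [_ fM fS fP] := free_lift_morphism f.
move=> Rf /bproj_eq ab; apply: (ab (fun c d => free_lift f c = free_lift f d)) => //.
split=> //; first by move=> ? ? ? ->.
- by move=> ? ? ? ? ? ?; rewrite !fM; congr (_ * _).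
- by move=> ? ? h; rewrite !fS h.
- by move=> ? ? h; rewrite !fP h.
Qed.

Lemma bmorph_square_proj (S T : birestrSigType) (f : S -> T) (a b c d : S) :
  birestr_morphism f ->
  f (square_proj a b c d) = square_proj (f a) (f b) (f c) (f d).
Proof. by case=> _ fM fS fP; rewrite /square_proj !(fM, fS, fP). Qed.

(** Each of the four sets of relations writes the product as [bar (u * v)] times a projection, on
    the right for [i_empty] and [i_rs], on the left for [i_ls] and [i_s]. *)
Lemma F_bar_ge (X : Type) i (u v : free_semigroup X) :
  let q := bproj (@N_rel X i) in
  natural_ge (q (bar (u * v))) (q (bar u) * q (bar v)).
Proof.
have [_ qM qS qP] := bproj_morphism (@N_rel X i).
rewrite /= -qM.
have rel r : N_rel i (bar u * bar v) r ->
    bproj (@N_rel X i) (bar u * bar v) = bproj (@N_rel X i) r.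
  by move=> h; apply/bproj_eq; exact: cong_gen_sub.
have ls : N_rel i (bar u * bar v) ((bar u)^[+] * bar (u * v)) ->
    natural_ge (bproj (@N_rel X i) (bar (u * v))) (bproj (@N_rel X i) (bar u * bar v)).
  by move/rel=> ->; rewrite qM qP; exact: natural_ge_plus_mul.
case: i qM qS qP rel ls => qM qS qP rel ls.
- by rewrite /natural_ge -qS -qM; apply: rel; constructor.
- by apply: ls; constructor.
- by rewrite (rel _ (N_rs_mul u v)) qM qS; exact: natural_ge_mul_star.
- by apply: ls; left; constructor.
Qed.

Theorem theorem11p1 (X : Type) (hX : exists x y : X, x <> y) (i : N_index) :
  ~ admits_geometric_model (F_ X i).
Proof.
case: hX => x [y xy] [M [phi [EM phiI phim _]]].
pose q := bproj (@N_rel X i); have qm : birestr_morphism q := bproj_morphism _.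
pose p (z z' : X) := bar (word2 z z').
pose e := square_proj (p x x) (p y x) (p y y) (p x y).
have ge z z' :
    natural_ge (phi (q (p z z'))) (phi (q (bar (letter z))) * phi (q (bar (letter z')))).
  by rewrite -(bmorphM phim); apply: bmorph_natural_ge phim _; exact: F_bar_ge.
(* Injectivity of [phi] pulls the identity of the E-unitary monoid back to the presented monoid. *)
have qE : q ((p x y)^[+] * e) = q e.
  apply: phiI; rewrite (bmorphM qm) (bmorph_plus qm) (bmorphM phim) (bmorph_plus phim).
  rewrite /e (bmorph_square_proj _ _ _ _ qm) (bmorph_square_proj _ _ _ _ phim).
  exact: E_unitary_square EM (ge x x) (ge y x) (ge y y) (ge x y).
apply: (@path_square_proj X x y xy).
have fm := free_lift_morphism (path_assign xy).
(* The identity now passes to the partial bijections of the path, where it fails at [P0]. *)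
have := presented_eq_lift (@path_N_rel X x y xy i) qE.
by rewrite (bmorphM fm) (bmorph_plus fm) (bmorph_square_proj _ _ _ _ fm) !free_lift_gen.
Qed.
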